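(* Let $X$ be a normed space whose norm is Fréchet differentiable (the case of a continuously Fréchet differentiable norm being included), $Z$ a normed space and $g:X\to Z$ a mapping. Then the following conditions are equivalent: (i) $g\in B_1^d(X,Z)$; (ii) there exists a mapping $f:X^2\to Z$ with the diagonal $g$ (i.e. $f(x,x)=g(x)$ for every $x\in X$) which is continuous with respect to the first variable and is Lipschitz and continuously Fréchet differentiable with respect to the second variable; (iii) there exists a mapping $f:X^2\to Z$ with the diagonal $g$ which is continuous with respect to the first variable and pointwise Lipschitz with respect to the second variable at every point of the diagonal $\Delta=\{(x,x):x\in X\}$.
   Context: Normed spaces are real. A mapping $h$ from an open subset of a normed space $X$ to a normed space $Y$ is Fréchet differentiable at $x_0$ if there is a continuous linear operator $T:X\to Y$ with $\lim_{u\to0}\frac{\|h(x_0+u)-h(x_0)-T(u)\|}{\|u\|}=0$; $T$ is then the derivative at $x_0$. It is (continuously) Fréchet differentiable if it is Fréchet differentiable at every point (and the derivative depends continuously on the point in the operator norm). The norm of $X$ is called (continuously) Fréchet differentiable if $x\mapsto\|x\|$ is (continuously) Fréchet differentiable on $X\setminus\{0\}$. A mapping $h:X\to Z$ is Lipschitz if $\sup_{x\neq y}\frac{\|h(x)-h(y)\|}{\|x-y\|}<\infty$; it is Lipschitz at a point $x\in X$ if $\sup_{y\in X,\,y\neq x}\frac{\|h(x)-h(y)\|}{\|x-y\|}<\infty$. For $f:X^2\to Z$: continuous with respect to the first variable means that $x\mapsto f(x,y)$ is continuous for every $y\in X$; Lipschitz (continuously Fréchet differentiable) with respect to the second variable means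 that for every $x\in X$ the mapping $y\mapsto f(x,y)$ is Lipschitz (continuously Fréchet differentiable); pointwise Lipschitz with respect to the second variable at every point of $\Delta$ means that for every $x\in X$ the mapping $y\mapsto f(x,y)$ is Lipschitz at the point $y=x$. $B_1^d(X,Z)$ (the stable first Baire class) is the collection of all mappings $g:X\to Z$ for which there is a sequence of continuous mappings $g_n:X\to Z$ that converges pointwise stably to $g$: for every $x\in X$ there is $n_0\in\mathbb N$ with $g_n(x)=g(x)$ for all $n>n_0$. *)

(* Defs.v *)
From HB Require Import structures.
From mathcomp Require Import all_boot all_order all_algebra.
From mathcomp Require Import all_classical all_reals all_analysis.

Set Implicit Arguments.
Unset Strict Implicit.
Unset Printing Implicit Defensive.

Import Order.TTheory GRing.Theory Num.Theory.
Import numFieldNormedType.Exports.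

Local Open Scope classical_set_scope.
Local Open Scope ring_scope.

(* The supremum is meaningful when T is linear and continuous; on unbounded
   sets the library's [sup] is 0. *)
Definition op_norm (R : realType) (X Y : normedModType R) (T : X -> Y) : R :=
  sup [set `|T u| | u in [set u : X | `|u| <= 1]].

Definition continuously_differentiable (R : realType) (X Y : normedModType R)
    (h : X -> Y) : Prop :=
  (forall x, differentiable h x) /\
  (forall x0, op_norm (fun u => 'd h x u - 'd h x0 u) @[x --> x0] --> (0 : R)).

Definition differentiable_norm (R : realType) (X : normedModType R) : Prop :=
  forall x : X, x != 0 -> differentiable (fun y : X => `|y| : R) x.

(* Finiteness of the supremum of the difference quotients based at x. *)
Definition lipschitz_at (R : realType) (X Z : normedModType R)
    (h : X -> Z) (x : X) : Prop :=
  has_ubound [set `|h x - h y| / `|x - y| | y in [set y : X | y != x]].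

Definition stable_Baire1 (X Z : topologicalType) (g : X -> Z) : Prop :=
  exists g_ : nat -> X -> Z,
    (forall n, continuous (g_ n)) /\
    (forall x, exists n0 : nat, forall n : nat, (n0 < n)%N -> g_ n x = g x).

(* Main.v *)
(* (i) => (ii). Let g_ n converge stably to g and put d k = g_ k.+1 - g_ k.
   Weight d k x by a C1 bump in y that is 1 at y = x and vanishes once |y - x|
   reaches the (capped) distance from x to the zero set of d k. If d k y = 0
   then the k-th term vanishes at (x, y) for all x; since d k y = 0 for large k,
   the series of weighted terms is a finite sum both for fixed x and for fixed
   y, and on the diagonal it telescopes to g. The bump is C1 because |y - x|^2
   is convex and differentiable in y, and a differentiable convex function has
   a continuous derivative.

   (iii) => (i). The sets A n of the x such that |f (x, x) - f (x, y)| is at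
   most n |x - y| for all y increase to X. Continuity of f in the first variable
   shows that A n is closed and that the diagonal of f is continuous on A n.
   Extend these restrictions to X by Dugundji's theorem. *)

Require Import Defs.
From HB Require Import structures.
From mathcomp Require Import all_boot all_order all_algebra ring lra.
From mathcomp Require Import all_classical all_reals all_analysis.
From mathcomp Require wochoice.

Set Implicit Arguments.
Unset Strict Implicit.
Unset Printing Implicit Defensive.

Import Order.TTheory GRing.Theory Num.Theory.
Import numFieldNormedType.Exports.

Local Open Scope classical_set_scope.
Local Open Scope ring_scope.

(** * Capped distance to a set *)

Lemma continuous_max0 {R : realType} {T : topologicalType} (h : T -> R) x :
  {for x, continuous h} -> {for x, continuous (fun u => Num.max 0 (h u))}.
Proof.
by move=> hc; apply: (@continuous_max R T (cst 0) h) => //; exact: cvg_cst.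
Qed.

(** The point 1 keeps the infimum over a nonempty set: for empty [C] the value is 1, so it is
    positive off every closed set, the empty one included. *)
Definition capped_dist {R : realType} {X : normedModType R} (C : set X)
    (x : X) : R :=
  inf (1 |` [set `|x - y| | y in C]).

Section CappedDist.
Context {R : realType} {X : normedModType R}.
Implicit Types (C : set X) (x y : X) (e : R).

Let has_inf_dist C x : has_inf (1 |` [set `|x - y| | y in C]).
Proof.
split; first by exists 1; left.
by exists 0 => _ [->//|[y _ <-]].
Qed.

Lemma capped_dist_ge0 C x : 0 <= capped_dist C x.
Proof.
apply: lb_le_inf; first by case: (has_inf_dist C x).
by move=> _ [->//|[y _ <-]].
Qed.

Lemma capped_dist_le1 C x : capped_dist C x <= 1.
Proof. by apply: ge_inf; [case: (has_inf_dist C x)|left]. Qed.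

Lemma capped_dist_le C x y : C y -> capped_dist C x <= `|x - y|.
Proof.
by move=> Cy; apply: ge_inf; [case: (has_inf_dist C x)|right; exists y].
Qed.

Lemma capped_dist_lt C x e : e <= 1 -> capped_dist C x < e ->
  exists2 y, C y & `|x - y| < e.
Proof.
move=> e1 /inf_lt[|_ [->|[y Cy <-]]]; first by case: (has_inf_dist C x).
  by rewrite ltNge e1.
by exists y.
Qed.

Lemma capped_dist_lip C x y : `|capped_dist C x - capped_dist C y| <= `|x - y|.
Proof.
suff H u v : capped_dist C u - capped_dist C v <= `|u - v|.
  by rewrite ler_norml lerNl opprB distrC H distrC H.
rewrite lerBlDr -lerBlDl; apply: lb_le_inf; first by case: (has_inf_dist C v).
move=> _ [->|[z Cz <-]].
  by rewrite lerBlDl (le_trans (capped_dist_le1 _ _))// lerDr.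
rewrite lerBlDl (le_trans (capped_dist_le _ Cz))//.
by rewrite (le_trans _ (ler_normD _ _))// addrA subrK.
Qed.

Lemma capped_dist_gt0 C x : closed C -> ~ C x -> 0 < capped_dist C x.
Proof.
move=> Ccl nCx; rewrite lt_neqAle capped_dist_ge0 andbT; apply/negP => /eqP d0.
apply: nCx; apply: Ccl => B /nbhs_normP[e /= e0 eB].
have [||y Cy xy] := @capped_dist_lt C x (Num.min e 1).
- by rewrite ge_min lexx orbT.
- by rewrite -d0 lt_min e0 ltr01.
by exists y; split=> //; apply: eB => /=; move: xy; rewrite lt_min => /andP[].
Qed.

Lemma capped_dist_cont C : continuous (capped_dist C).
Proof.
move=> x; apply/cvgrPdist_lt => e e0; apply/nbhs_normP; exists e => //= y xy.
exact: le_lt_trans (capped_dist_lip _ _ _) xy.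
Qed.

End CappedDist.

(** * Dugundji's extension theorem *)

Section Blend.
Context {R : realType} {X Z : normedModType R}.
Variables (p : X -> R) (w : nat -> X -> R) (z : nat -> X -> Z).

(* rest n is the mass of p left over by the first n weights; since [blend n x]
   is final once [rest n x = 0], no infinite sum is needed. *)
Fixpoint rest n x : R := if n is m.+1 then rest m x * (1 - w m x) else p x.

Fixpoint blend n x : Z :=
  if n is m.+1 then blend m x + rest m x *: (w m x *: z m x) else 0.

Lemma rest_cont : continuous p -> (forall n, continuous (w n)) ->
  forall n, continuous (rest n).
Proof.
move=> pc wc; elim=> [//|n IH] x /=.
by apply: cvgM; [exact: IH|apply: cvgB; [exact: cvg_cst|exact: wc]].
Qed.

(** Continuity is asked of the products [w n x *: z n x] only, because in the application [z n]
    comes from chosen points and may jump where [w n] vanishes. *)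
Lemma blend_cont : continuous p -> (forall n, continuous (w n)) ->
  (forall n, continuous (fun x => w n x *: z n x)) ->
  forall n, continuous (blend n).
Proof.
move=> pc wc wzc; elim=> [|n IH] x /=; first exact: cvg_cst.
apply: cvgD; first exact: IH.
by apply: cvgZ; [exact: rest_cont|exact: wzc].
Qed.

Lemma blend_stop m n x : rest m x = 0 -> (m <= n)%N ->
  rest n x = 0 /\ blend n x = blend m x.
Proof.
move=> r0; elim: n => [|n IH]; first by rewrite leqn0 => /eqP <-.
rewrite leq_eqVlt => /predU1P[<-//|]; rewrite ltnS => /IH[rn bn] /=.
by rewrite rn mul0r scale0r addr0 bn.
Qed.

Lemma blend_stop_eq m n x : rest m x = 0 -> rest n x = 0 ->
  blend m x = blend n x.
Proof.
move=> rm rn; have [mn|/ltnW nm] := leqP m n.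
  by have [_ ->] := blend_stop rm mn.
by have [_ ->] := blend_stop rn nm.
Qed.

Lemma rest_bounds n x : 0 <= p x -> (forall n, 0 <= w n x <= 1) ->
  0 <= rest n x <= p x.
Proof.
move=> p0 w01; elim: n => [|n /andP[r0 rp]] /=; first by rewrite p0 lexx.
have /andP[w0 w1] := w01 n.
by rewrite mulr_ge0 ?subr_ge0//= (le_trans _ rp)// ler_piMr// gerBl.
Qed.

(* The partial blends are sums of the z n x with nonnegative weights of total
   mass p x - rest n x. *)
Lemma blend_near c e n x : 0 <= p x -> (forall n, 0 <= w n x <= 1) ->
  (forall n, 0 < w n x -> `|z n x - c| <= e) ->
  `|blend n x - (p x - rest n x) *: c| <= (p x - rest n x) * e.
Proof.
move=> p0 w01 wz; elim: n => [|n IH] /=.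
  by rewrite subrr scale0r mul0r subr0 normr0.
have /andP[r0 _] := rest_bounds n p0 w01.
have -> : p x - rest n x * (1 - w n x) = (p x - rest n x) + rest n x * w n x.
  by ring.
rewrite scalerDl mulrDl opprD addrACA (le_trans (ler_normD _ _))// lerD//.
rewrite scalerA -scalerBr normrZ.
have /andP[] := w01 n; rewrite le_eqVlt => /predU1P[<- _|w0 _].
  by rewrite mulr0 normr0 !mul0r.
have rw0 : 0 <= rest n x * w n x by rewrite mulr_ge0// ltW.
by rewrite ger0_norm// ler_wpM2l// wz.
Qed.

End Blend.

(* m S is the least element of S for a well-ordering of T. *)
Lemma consistent_choice (T : pointedType) : exists m : set T -> T,
  (forall S, S !=set0 -> S (m S)) /\
  (forall S S', S !=set0 -> S' !=set0 ->
    S (m S') -> S' (m S) -> m S = m S').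
Proof.
have [r r_wo] := wochoice.well_ordering_principle T.
have /choice[m mP] (S : set T) : exists a, S !=set0 ->
    S a /\ forall b, S b -> r a b.
  have [[s Ss]|nS] := pselect (S !=set0); last by exists point => /nS.
  have [|a [[Sa am] _]] := r_wo (mem S); first by exists s; rewrite inE.
  exists a => _; split=> [|b Sb]; first by move: Sa; rewrite inE.
  by apply: am; rewrite inE.
exists m; split=> [S /mP[]//|S S' /mP[Sm lm] /mP[Sm' lm'] SmS' S'mS].
(* Both chosen points are least in the intersection of the two sets, and a least element is
   unique. *)
have [|a [_ a_uniq]] := r_wo (mem (S `&` S')).
  by exists (m S); rewrite !inE.
have <- : a = m S by apply: a_uniq; split=> [|b]; rewrite inE// => -[/lm].
by apply: a_uniq; split=> [|b]; rewrite inE// => -[_ /lm'].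
Qed.

Section Extension.
Context {R : realType} {X Z : normedModType R}.
Variables (A : set X) (g : X -> Z) (m : set X -> X).
Hypotheses (A_closed : closed A) (g_cont : {within A, continuous g}).
Hypotheses (m_in : forall S, S !=set0 -> S (m S))
  (m_eq : forall S S', S !=set0 -> S' !=set0 ->
    S (m S') -> S' (m S) -> m S = m S').

Let rho := capped_dist A.

Let near_pts y := [set a | A a /\ `|y - a| < 2 * rho y].

Let pi y := m (near_pts y).

Let eps n : R := n.+1%:R^-1.

(* The sets C n cover the points y off A with rho y < 1, and pi, although
   discontinuous, is constant on the part of C n in any ball of radius
   eps n / 6. This replaces a locally finite refinement in Dugundji's proof. *)
Let C n := [set y | near_pts y (pi y) /\ eps n <= 2 * rho y - `|y - pi y|].

Let eps_gt0 n : 0 < eps n. Proof. by rewrite invr_gt0 ltr0n. Qed.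

Let eps_le1 n : eps n <= 1.
Proof. by rewrite invf_le1 ?ltr0n// ler1n. Qed.

(** Moving from one point to the other changes twice [rho] and the distance to the chosen point by
    less than [eps n] in total. The slack in [C n] absorbs this, so each chosen point is a candidate
    for the other point too, and [m_eq] applies. *)
Let pi_sep n y y' : C n y -> C n y' -> `|y - y'| < eps n / 3 -> pi y = pi y'.
Proof.
suff H u v : C n u -> C n v -> `|u - v| < eps n / 3 -> near_pts u (pi v).
  move=> Cy Cy' yy'; apply: m_eq.
  - by exists (pi y); case: Cy.
  - by exists (pi y'); case: Cy'.
  - exact: H Cy Cy' yy'.
  - by apply: H Cy' Cy _; rewrite distrC.
move=> [[_ _] _] [[Av _] ev] uv; split => //.
have := capped_dist_lip A u v; rewrite -/rho ler_norml => /andP[h _].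
have : `|u - pi v| <= `|u - v| + `|v - pi v|.
  by rewrite (le_trans _ (ler_normD _ _))// addrA subrK.
lra.
Qed.

(** Below the cap, [rho y] is the true distance to [A], so [near_pts y] is nonempty and [pi y] has
    positive slack, which exceeds some [eps n]. *)
Let cover y : 0 < rho y < 1 -> exists n, C n y.
Proof.
move=> /andP[r0 r1].
have /m_in near_pi : near_pts y !=set0.
  have [||a Aa ya] := @capped_dist_lt _ _ A y (Num.min 1 (2 * rho y)).
  - by rewrite ge_min lexx.
  - rewrite lt_min r1 -/rho; lra.
  - by exists a; split => //; move: ya; rewrite lt_min => /andP[].
have : 0 < 2 * rho y - `|y - pi y| by rewrite subr_gt0; case: near_pi.
move=> /ltr_add_invr[n]; rewrite add0r => /ltW en.
by exists n; split.
Qed.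

(* 1 within eps n / 18 of C n, and 0 beyond eps n / 9. *)
Let wt n x : R :=
  Num.min 1 (Num.max 0 (2 - 18 * n.+1%:R * capped_dist (C n) x)).

Let wt01 n x : 0 <= wt n x <= 1.
Proof. by rewrite /wt ge_min lexx /= le_min ler01 /= le_max lexx. Qed.

Let wt_cont n : continuous (wt n).
Proof.
move=> x; apply: (@continuous_min _ _ (cst 1 : X -> R^o)); first exact: cvg_cst.
apply: continuous_max0.
apply: cvgB; first exact: cvg_cst.
by apply: cvgM; [exact: cvg_cst|exact: capped_dist_cont].
Qed.

Let wt_gt0 n x : 0 < wt n x -> exists2 y, C n y & `|x - y| < eps n / 9.
Proof.
rewrite /wt lt_min ltr01 /= lt_max ltxx /= => h.
apply: capped_dist_lt; first by have := eps_le1 n; lra.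
rewrite ltr_pdivlMr// /eps.
have n0 : (0 : R) < n.+1%:R by rewrite ltr0n.
rewrite -div1r ltr_pdivlMr//; lra.
Qed.

Let wt_eq1 n y : C n y -> \forall x \near y, wt n x = 1.
Proof.
move=> Cy; apply/nbhs_normP; exists (eps n / 18) => /= [|x].
  by rewrite divr_gt0.
rewrite /ball_ /= distrC ltr_pdivlMr// /eps -div1r.
have n0 : (0 : R) < n.+1%:R by rewrite ltr0n.
rewrite ltr_pdivlMr// => xy.
apply/min_idPl; rewrite le_max; apply/orP; right.
have := capped_dist_le x Cy; move: (capped_dist _ x) => c.
rewrite -(ler_pM2l (_ : 0 < 18 * n.+1%:R)) ?mulr_gt0//.
lra.
Qed.

Let source n x : exists y, 0 < wt n x -> C n y /\ `|x - y| < eps n / 9.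
Proof.
have [/wt_gt0[y Cy xy]|_] := ltP 0 (wt n x); first by exists y.
by exists 0.
Qed.

(** Off [A] the extension blends values of [g] at points [pi (s n x)]. Near a point off [A] a fixed
    partial blend is final, hence continuity there; near a point of [A] the points used are close to
    it and the total mass is close to 1. *)
Lemma closed_extension : exists h : X -> Z,
  continuous h /\ forall x, A x -> h x = g x.
Proof.
pose s n := projT1 (choice (source n)).
have sP n : forall x, 0 < wt n x -> C n (s n x) /\ `|x - s n x| < eps n / 9.
  exact: projT2 (choice (source n)).
pose z n x := g (pi (s n x)).
have wz_cont n : continuous (fun x => wt n x *: z n x).
  move=> x0.
  have [c cP] : exists c, \forall x \near x0, wt n x *: z n x = wt n x *: c.
    have [[x1 x01 w1]|nw] := pselect (exists2 x1,
        `|x0 - x1| < eps n / 18 & 0 < wt n x1).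
      exists (z n x1); apply/nbhs_normP; exists (eps n / 18) => /= [|x].
        by rewrite divr_gt0.
      rewrite /ball_ /= => x0x.
      have [/sP[Cx xs]|w0] := ltP 0 (wt n x).
        have [Cx1 xs1] := sP _ _ w1.
        congr (_ *: g _); apply: pi_sep Cx Cx1 _.
        (* Two steps below [eps n / 9] and two below [eps n / 18] stay below the [eps n / 3] of
           [pi_sep]. *)
        have -> : s n x - s n x1 =
          ((s n x - x) + (x - x0)) + ((x0 - x1) + (x1 - s n x1)).
          by rewrite addrA !subrKA.
        rewrite (le_lt_trans (ler_normD _ _))//.
        have := ler_normD (s n x - x) (x - x0).
        have := ler_normD (x0 - x1) (x1 - s n x1).
        move: xs x0x; rewrite distrC [`|x0 - x|]distrC; lra.
      have -> : wt n x = 0.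
        by apply/eqP; rewrite eq_le w0; case/andP: (wt01 n x).
      by rewrite !scale0r.
    exists 0; apply/nbhs_normP; exists (eps n / 18) => /= [|x x0x].
      by rewrite divr_gt0.
    rewrite scaler0; have [w0|w0] := ltP 0 (wt n x).
      by exfalso; apply: nw; exists x.
    have -> : wt n x = 0.
      by apply/eqP; rewrite eq_le w0; case/andP: (wt01 n x).
    by rewrite scale0r.
  have wc : wt n x *: c @[x --> x0] --> wt n x0 *: c.
    by apply: cvgZ; [exact: wt_cont|exact: cvg_cst].
  rewrite /continuous_at (nbhs_singleton cP).
  by apply: cvg_trans wc; apply: near_eq_cvg; apply: filterS cP => x ->.
(* The mass is 1 on [A] and vanishes where [rho] is at least 1/2, which settles the points with
   [rho x = 1] that [cover] leaves out. *)
pose p x := Num.max 0 (1 - 2 * rho x).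
have p_cont : continuous p.
  move=> x; apply: (@continuous_max0 _ _ (fun x => 1 - 2 * rho x)).
  apply: cvgB; first exact: cvg_cst.
  by apply: cvgM; [exact: cvg_cst|exact: capped_dist_cont].
have p0 x : 0 <= p x by rewrite /p le_max lexx.
have rest0 x : ~ A x -> exists n, \forall y \near x, rest p wt n y = 0.
  move=> nAx; have r0 : 0 < rho x by exact: capped_dist_gt0.
  have [r1|r1] := ltP (rho x) 1.
    have [|n Cx] := @cover x; first by rewrite r0.
    exists n.+1; near=> y => /=.
    suff -> : wt n y = 1 by rewrite subrr mulr0.
    by near: y; exact: wt_eq1.
  exists 0%N; have : \forall y \near x, 2^-1 < rho y.
    by apply: (cvgr_gt (rho x)); [exact: capped_dist_cont|lra].
  by apply: filterS => y hy; apply/max_idPl; lra.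
have /choice[N NP] x : exists n, ~ A x -> rest p wt n x = 0.
  have [Ax|nAx] := pselect (A x); first by exists 0%N.
  by have [n /nbhs_singleton rn] := rest0 x nAx; exists n.
pose h x := if `[< A x >] then g x else blend p wt z (N x) x.
have hA x : A x -> h x = g x by move=> Ax; rewrite /h asboolT.
(* [N] has no regularity in [x], but any index at which the rest vanishes gives the same value, so
   one index serves on a whole neighbourhood. *)
have hnA x n : ~ A x -> rest p wt n x = 0 -> h x = blend p wt z n x.
  by move=> nAx rn; rewrite /h asboolF//; apply: blend_stop_eq => //; exact: NP.
exists h; split=> // x0; have [Ax0|nAx0] := pselect (A x0); last first.
  have [n rn] := rest0 _ nAx0.
  have nA : \forall x \near x0, ~ A x.
    by apply: open_nbhs_nbhs; split => //; exact: closed_openC.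
  have hn : \forall x \near x0, blend p wt z n x = h x.
    by near=> x; rewrite (hnA x n)//; near: x.
  rewrite /continuous_at -(nbhs_singleton hn).
  apply: cvg_trans (near_eq_cvg hn) _.
  exact: blend_cont.
rewrite /continuous_at hA//.
(* Twice [rho x] contributes at most [2 * |x0 - x|]; the slack [eps n] outweighs the three errors of
   size [eps n / 9]. *)
have pi_near n x : 0 < wt n x -> A (pi (s n x)) /\
    `|x0 - pi (s n x)| <= 3 * `|x0 - x|.
  move=> /sP[[[As _] es] xs]; split=> //.
  have : rho x <= `|x - x0| by exact: capped_dist_le.
  have := capped_dist_lip A x (s n x); rewrite -/rho ler_norml => /andP[h1 _].
  have : `|x0 - pi (s n x)| <=
      `|x0 - x| + (`|x - s n x| + `|s n x - pi (s n x)|).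
    have -> : x0 - pi (s n x) = (x0 - x) + ((x - s n x) + (s n x - pi (s n x))).
      by rewrite !addrA subrK subrK.
    by rewrite (le_trans (ler_normD _ _))// lerD2l ler_normD.
  move: (eps_gt0 n); rewrite (distrC x x0); lra.
have /subspace_continuousP/(_ _ Ax0)/cvgrPdist_le g_near := g_cont.
apply/cvgrPdist_le => e e0.
have e2 : 0 < e / 2 by lra.
have := g_near _ e2; rewrite near_withinE => /nbhs_normP[d /= d0 dP].
pose G := 1 + `|g x0|.
have G0 : 0 < G by rewrite ltr_pwDl.
(* [d / 3] answers the factor 3 of [pi_near]; the other bound makes the missing mass [1 - p x], at
   most [2 * |x0 - x|], cost at most [e / 2]. *)
apply/nbhs_normP; exists (Num.min (d / 3) (e / (4 * G))) => /= [|x].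
  by rewrite lt_min !divr_gt0// mulr_gt0.
rewrite /ball_ /= lt_min => /andP[xd xe].
have [Ax|nAx] := pselect (A x).
  rewrite hA// (le_trans (dP x _ Ax)) /ball_ /= ?ltr_pdivrMr//; last by lra.
  lra.
rewrite (hnA x (N x))//; last exact: NP.
have pr : p x - rest p wt (N x) x = p x by rewrite NP// subr0.
have := @blend_near _ _ _ p wt z (g x0) (e / 2) (N x) x (p0 x) (wt01^~ x).
rewrite pr => /(_ _)/wrap[n wn|bl].
  have [Apx pix] := pi_near _ _ wn.
  rewrite distrC; apply: dP => //; rewrite /ball_ /=; lra.
have p1 : p x <= 1.
  by rewrite /p ge_max ler01 /= gerBl mulr_ge0// capped_dist_ge0.
have pgx : (1 - p x) * `|g x0| <= e / 2.
  have : 1 - p x <= 2 * `|x0 - x|.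
    have : 1 - 2 * rho x <= p x by rewrite /p le_max lexx orbT.
    have : rho x <= `|x - x0| by exact: capped_dist_le.
    rewrite distrC; lra.
  move: xe; rewrite ltr_pdivlMr ?mulr_gt0// /G.
  have := normr_ge0 (g x0); have := normr_ge0 (x0 - x).
  nra.
have -> : g x0 - blend p wt z (N x) x =
    (1 - p x) *: g x0 - (blend p wt z (N x) x - p x *: g x0).
  by rewrite scalerBl scale1r opprB addrA subrK.
rewrite (le_trans (ler_normB _ _))// normrZ ger0_norm ?subr_ge0//.
have : p x * (e / 2) <= e / 2 by rewrite ler_piMl// ltW.
lra.
Unshelve. all: by end_near. Qed.

End Extension.

Lemma dugundji_extension (R : realType) (X Z : normedModType R) (A : set X)
    (g : X -> Z) : closed A -> {within A, continuous g} ->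
  exists h : X -> Z, continuous h /\ forall x, A x -> h x = g x.
Proof.
move=> A_closed g_cont; have [m [m_in m_eq]] := consistent_choice X.
exact: closed_extension g_cont m_in m_eq.
Qed.

(** * Diagonals of pointwise Lipschitz functions are stable limits *)

Section DiagonalLipschitz.
Context {R : realType} {X Z : normedModType R}.
Variable f : X * X -> Z.
Hypothesis f_cont : forall y, continuous (fun x => f (x, y)).

Let A (n : nat) :=
  [set x | forall y, `|f (x, x) - f (x, y)| <= n%:R * `|x - y|].

Let f_near (y x : X) (e : R) : 0 < e ->
  \forall u \near x, `|f (x, y) - f (u, y)| <= e.
Proof. by move=> e0; have /cvgrPdist_le/(_ _ e0) := @f_cont y x. Qed.

Let dist_near (x : X) (e : R) : 0 < e -> \forall u \near x, `|x - u| <= e.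
Proof.
by move=> e0; apply/nbhs_normP; exists e => // u; rewrite /ball_ /= => /ltW.
Qed.

Let A_closed n : closed (A n).
Proof.
move=> x clx y; apply/ler_addgt0Pl => e e0.
(* Two errors [d] come from moving the first variable from [x] to [u], and two errors [n * d] from
   the bounds at [u] in [A n]. *)
pose d := e / (2 + 2 * n%:R).
have n0 : (0 : R) <= n%:R by rewrite ler0n.
have n1 : (0 : R) < 2 + 2 * n%:R by lra.
have d0 : 0 < d by rewrite divr_gt0.
have [u [Au [[ux uy] xu]]] : exists u, A n u /\
    (`|f (x, x) - f (u, x)| <= d /\ `|f (x, y) - f (u, y)| <= d) /\
    `|x - u| <= d.
  have [u []] := clx _ (filterI (filterI (f_near x x d0) (f_near y x d0))
    (dist_near x d0)).
  by exists u.
have := Au x; have := Au y => Auy Aux.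
have -> : f (x, x) - f (x, y) = ((f (x, x) - f (u, x)) - (f (u, u) - f (u, x)))
    + ((f (u, u) - f (u, y)) - (f (x, y) - f (u, y))).
  by rewrite !opprB !addrA !subrK.
have t1 := ler_normB (f (x, x) - f (u, x)) (f (u, u) - f (u, x)).
have t2 := ler_normB (f (u, u) - f (u, y)) (f (x, y) - f (u, y)).
rewrite (le_trans (ler_normD _ _))//.
have uyd : `|u - y| <= d + `|x - y|.
  have -> : u - y = (u - x) + (x - y) by rewrite addrA subrK.
  by rewrite (le_trans (ler_normD _ _))// lerD2r distrC.
have -> : e = d + d + n%:R * d + n%:R * d by rewrite /d; field; lra.
have := ler_wpM2l n0 uyd; have := ler_wpM2l n0 xu.
rewrite (distrC x u) mulrDr; lra.
Qed.

Let A_cont n : {within A n, continuous (fun x => f (x, x))}.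
Proof.
apply/subspace_continuousP => x Ax; apply/cvgrPdist_le => e e0.
rewrite near_withinE.
have n0 : (0 : R) <= n%:R by rewrite ler0n.
have d0 : 0 < e / (1 + n%:R) by rewrite divr_gt0// ltr_pwDl.
near=> u => Au.
(* Through [f (u, x)], the first difference moves only the first variable and the second is
   controlled by [u] in [A n]. *)
have -> : f (x, x) - f (u, u) = (f (x, x) - f (u, x)) - (f (u, u) - f (u, x)).
  by rewrite opprB addrA subrK.
rewrite (le_trans (ler_normB _ _))//.
have := Au x; rewrite distrC (distrC u).
have : `|f (x, x) - f (u, x)| <= e / (1 + n%:R) by near: u; exact: f_near.
have : n%:R * `|x - u| <= n%:R * (e / (1 + n%:R)).
  by rewrite ler_wpM2l//; near: u; exact: dist_near.
have {3}-> : e = e / (1 + n%:R) + n%:R * (e / (1 + n%:R)) by field; lra.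
lra.
Unshelve. all: by end_near. Qed.

Lemma stable_Baire1_diagonal :
  (forall x, lipschitz_at (fun y => f (x, y)) x) ->
  stable_Baire1 (fun x => f (x, x)).
Proof.
move=> f_lip.
have ext n : exists h : X -> Z,
    continuous h /\ forall x, A n x -> h x = f (x, x).
  exact: dugundji_extension (@A_closed n) (@A_cont n).
have [h hP] := choice ext.
exists h; split=> [n|x]; first by case: (hP n).
have [M Mub] := f_lip x.
exists (Num.truncn M).+1 => n Mn; apply: (hP n).2 => y.
have [->|yx] := eqVneq y x; first by rewrite !subrr !normr0 mulr0.
have xy0 : 0 < `|x - y| by rewrite normr_gt0 subr_eq0 eq_sym.
rewrite -ler_pdivrMr// (le_trans (Mub _ _))//; first by exists y.
rewrite (le_trans (ltW (truncnS_gt M)))// ler_nat.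
exact: ltnW.
Qed.

End DiagonalLipschitz.

(** * Continuously differentiable functions *)

Section Differentials.
Context {R : realType} {X Y : normedModType R}.

Lemma near_diff (h : X -> Y) x (e : R) : differentiable h x -> 0 < e ->
  \forall u \near 0, `|h (u + x) - h x - 'd h x u| <= e * `|u|.
Proof.
move=> /diff_locally/eqaddoP hx e0; have := hx _ e0.
by apply: filterS => u; rewrite /= !fctE /= opprD addrA.
Qed.

Lemma diffI (h T : X -> Y) x : linear T -> continuous T ->
  (forall e, 0 < e ->
    \forall u \near 0, `|h (u + x) - h x - T u| <= e * `|u|) ->
  differentiable h x /\ 'd h x = T :> (X -> Y).
Proof.
move=> Tlin Tcont hT.
pose TL : {linear _ -> _} := HB.pack T (GRing.isLinear.Build _ _ _ _ _ Tlin).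
have hTL : h \o shift x = cst (h x) + TL +o_ 0 id.
  apply/eqaddoP => e e0; have := hT _ e0.
  by apply: filterS => u; rewrite /= !fctE /= opprD addrA.
have dE : 'd h x = TL :> (X -> Y) by exact: diff_unique.
by split => //; apply/diff_locallyP; rewrite dE.
Qed.

(** Operator-norm continuity of the derivative, as a bound for all [u], so that no supremum has to
    be handled. *)
Definition C1 (h : X -> Y) :=
  (forall x, differentiable h x) /\
  forall x0 (e : R), 0 < e ->
    \forall x \near x0, forall u, `|'d h x u - 'd h x0 u| <= e * `|u|.

Lemma C1_continuously_differentiable h : C1 h -> continuously_differentiable h.
Proof.
move=> [hd hc]; split=> // x0; apply/cvgrPdist_le => e e0.
have := hc x0 _ e0; apply: filterS => x xP.
rewrite sub0r normrN /op_norm; set S := (X in sup X).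
have Sub : ubound S e.
  move=> _ [u /= u1 <-]; rewrite (le_trans (xP u))// ler_piMr//; exact: ltW.
have S0 : S `|'d h x 0 - 'd h x0 0| by exists 0 => //=; rewrite normr0.
rewrite ger0_norm; first by apply: ge_sup => //; exists `|'d h x 0 - 'd h x0 0|.
by apply: le_trans (normr_ge0 _) (ub_le_sup _ S0); exists e.
Qed.

Lemma C1_cst c : C1 (fun=> c).
Proof.
split=> [x|x0 e e0]; first exact: differentiable_cst.
by apply: nearW => x u; rewrite !diff_cst/= subrr normr0 mulr_ge0// ltW.
Qed.

Lemma C1D h k : C1 h -> C1 k -> C1 (fun x => h x + k x).
Proof.
move=> [hd hc] [kd kc]; split=> [x|x0 e e0]; first exact: differentiableD.
have e2 : 0 < e / 2 by lra.
move: (hc x0 _ e2) (kc x0 _ e2); apply: filterS2 => x hx kx u.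
have dE y : 'd (fun x => h x + k x) y u = 'd h y u + 'd k y u.
  by rewrite (diffD (hd y) (kd y)).
rewrite !dE opprD addrACA [e]splitr mulrDl.
exact: le_trans (ler_normD _ _) (lerD (hx u) (kx u)).
Qed.

End Differentials.

Lemma C1_sum {R : realType} {X Y : normedModType R} (n : nat)
    (h : nat -> X -> Y) :
  (forall k, C1 (h k)) -> C1 (fun x => \sum_(k < n) h k x).
Proof.
move=> hC; elim: n => [|n IH].
  have -> : (fun x => \sum_(k < 0) h k x) = fun=> 0.
    by apply/funext => x; rewrite big_ord0.
  exact: C1_cst.
have -> : (fun x => \sum_(k < n.+1) h k x) =
    fun x => \sum_(k < n) h k x + h n x.
  by apply/funext => x; rewrite big_ord_recr.
exact: C1D IH (hC n).
Qed.

Section ScalarC1.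
Context {R : realType} {X : normedModType R}.
Implicit Types h : X -> R.

Lemma C1Zl (Z : normedModType R) h (z : Z) : C1 h -> C1 (fun x => h x *: z).
Proof.
move=> [hd hc]; split=> [x|x0 e e0]; first exact: differentiableZl.
have z0 : 0 < 1 + `|z| by rewrite ltr_pwDl.
have ez0 : 0 < e / (1 + `|z|) by rewrite divr_gt0.
have := hc x0 _ ez0; apply: filterS => x hx u.
rewrite !diffZl//= -scalerBl normrZ.
have := ler_wpM2r (normr_ge0 z) (hx u).
have := normr_ge0 z; have := normr_ge0 u.
have -> : e * `|u| = e / (1 + `|z|) * `|u| * (1 + `|z|) by field; lra.
move: (e / _) ez0 => d d0; move: `|u| `|z| => a b.
nra.
Qed.

Lemma C1_comp (P p : R -> R) h :
  (forall t, differentiable P t /\ 'd P t = (fun s => p t * s) :> (R -> R)) ->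
  continuous p -> C1 h -> C1 (P \o h).
Proof.
move=> Pp p_cont [hd hc]; split=> [x|x0 e e0].
  by apply: differentiable_comp => //; exact: (Pp _).1.
have [k k0 hk] : exists2 k, k > 0 & forall u, `|'d h x0 u| <= k * `|u|.
  by apply: linear_lipschitz; exact: diff_continuous.
pose M := `|p (h x0)| + 1.
have M0 : 0 < M by rewrite ltr_wpDl.
have eM : 0 < e / (2 * M) by rewrite divr_gt0// mulr_gt0.
have ek : 0 < e / (2 * k) by rewrite divr_gt0// mulr_gt0.
have ph_cont : {for x0, continuous (p \o h)}.
  by apply: continuous_comp; [exact: differentiable_continuous|exact: p_cont].
have /cvgrPdist_le ph := ph_cont.
move: (ph _ ltr01) (ph _ ek) (hc x0 _ eM).
apply: filterS3 => x /= ph1 phe hx u.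
have dE y : 'd (P \o h) y u = p (h y) * 'd h y u.
  by rewrite (diff_comp (hd y) (Pp _).1) /= (Pp _).2.
rewrite !dE.
have -> : p (h x) * 'd h x u - p (h x0) * 'd h x0 u =
  p (h x) * ('d h x u - 'd h x0 u) - (p (h x0) - p (h x)) * 'd h x0 u by ring.
rewrite (le_trans (ler_normB _ _))// !normrM.
have pM : `|p (h x)| <= M.
  have := lerB_dist (p (h x)) (p (h x0)).
  rewrite distrC /M; lra.
have a1 : `|p (h x)| * `|'d h x u - 'd h x0 u| <= M * (e / (2 * M) * `|u|).
  by rewrite ler_pM.
have a2 : `|p (h x0) - p (h x)| * `|'d h x0 u| <= e / (2 * k) * (k * `|u|).
  by rewrite ler_pM.
have -> : e * `|u| = M * (e / (2 * M) * `|u|) + e / (2 * k) * (k * `|u|).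
  by field; rewrite ?lt0r_neq0.
exact: lerD.
Qed.

(** * Derivatives of convex functions *)

Section Convex.
Variable h : X -> R.
Hypothesis h_convex : forall x y (t : R), 0 <= t <= 1 ->
  h (x + t *: (y - x)) <= h x + t * (h y - h x).

(** At [x + t *: (y - x)] convexity bounds [h] from above and differentiability from below;
    comparing the two and dividing by a small [t] leaves an error at most [e]. *)
Lemma convex_diff_le x y : differentiable h x -> h x + 'd h x (y - x) <= h y.
Proof.
move=> hx; apply/ler_addgt0Pl => e e0.
set u := y - x; pose d := e / (1 + `|u|).
have u0 : 0 < 1 + `|u| by rewrite ltr_pwDl.
have d0 : 0 < d by rewrite divr_gt0.
have /nbhs_normP[r /= r0 rP] := near_diff hx d0.
pose t := Num.min 1 (r / (2 * (1 + `|u|))).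
have t0 : 0 < t by rewrite lt_min ltr01 divr_gt0// mulr_gt0.
have t1 : t <= 1 by rewrite ge_min lexx.
have tur : `|t *: u| < r.
  rewrite normrZ gtr0_norm//.
  have : t <= r / (2 * (1 + `|u|)) by rewrite ge_min lexx orbT.
  rewrite ler_pdivlMr ?mulr_gt0//; have := normr_ge0 u; nra.
have := rP (t *: u); rewrite /ball_ /= sub0r normrN => /(_ tur).
have dZ : 'd h x (t *: u) = t * ('d h x u : R) :> R by rewrite linearZ.
rewrite normrZ gtr0_norm// dZ [t *: u + x]addrC.
rewrite ler_norml => /andP[+ _].
have := h_convex x y (t := t); rewrite (ltW t0) t1 => /(_ isT).
rewrite -/u.
have : d * (t * `|u|) <= t * e.
  rewrite mulrCA ler_pM2l// /d mulrAC ler_pdivrMr// mulrDr mulr1.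
  by rewrite lerDr ltW.
move=> h1 h2 h3.
move: ('d h x _) h1 h2 h3 => D h1 h2 h3.
rewrite -(ler_pM2l t0); lra.
Qed.

(* The subgradient inequality at x, applied to x0 + v and to x + (x - x0),
   bounds ('d h x - 'd h x0) v for all v of a fixed small norm. *)
Lemma convex_C1 : (forall x, differentiable h x) -> C1 h.
Proof.
move=> hd; split=> // x0 e e0.
have e4 : 0 < e / 4 by lra.
have /nbhs_normP[r /= r0 rP] := near_diff (hd x0) e4.
pose s := r / 2.
have s0 : 0 < s by rewrite /s; lra.
have es : 0 < e / 4 * s by rewrite mulr_gt0.
have hc : {for x0, continuous h} by exact: differentiable_continuous.
have hc2 : h (x + (x - x0)) @[x --> x0] --> h x0.
  have c2 : (x + (x - x0)) @[x --> x0] --> x0.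
    rewrite -{3}[x0]addr0 -(subrr x0).
    by apply: cvgD; [exact: cvg_id|apply: cvgB; [exact: cvg_id|exact: cvg_cst]].
  exact: cvg_comp c2 hc.
move/cvgrPdist_le : hc => /(_ _ es) n1; move/cvgrPdist_le : hc2 => /(_ _ es) n2.
move: n1 n2; apply: filterS2 => x n1 n2.
suff H u : 'd h x u - 'd h x0 u <= e * `|u|.
  move=> u; rewrite ler_norml H andbT lerNl opprB.
  by have := H (- u); rewrite !linearN normrN opprK addrC.
have d0 z : 'd h z 0 = 0 :> R by rewrite linear0.
have [->|u0] := eqVneq u 0; first by rewrite !d0 subr0 normr0 mulr0.
have nu : 0 < `|u| by rewrite normr_gt0.
pose v := (s / `|u|) *: u.
have vs : `|v| = s by rewrite normrZ gtr0_norm ?divr_gt0// divfK ?gt_eqF.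
have uE : u = (`|u| / s) *: v.
  by rewrite scalerA mulrA divfK ?gt_eqF// divff ?gt_eqF// scale1r.
have dZ z c : 'd h z (c *: v) = c * 'd h z v :> R by rewrite linearZ.
have dB z a b : 'd h z (a - b) = ('d h z a : R) - 'd h z b by rewrite linearB.
rewrite {1 2}uE !dZ -mulrBr.
have -> : e * `|u| = (`|u| / s) * (e * s) by field; rewrite gt_eqF.
rewrite ler_pM2l ?divr_gt0//.
have := rP v; rewrite /ball_ /= sub0r normrN vs => /(_ _)/wrap[|].
  by rewrite /s; lra.
rewrite ler_norml => /andP[_ h1].
have := convex_diff_le (v + x0) (hd x).
have := convex_diff_le (x + (x - x0)) (hd x).
have -> : v + x0 - x = v - (x - x0) by rewrite opprB addrA.
rewrite (addrC x (x - x0)) addrK (dB x v).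
move: n1 n2; rewrite (addrC x (x - x0)) !ler_norml => /andP[_ n1] /andP[n2 _].
(* [D'] stands for ['d h x (x - x0)], not controlled beforehand: it enters the two subgradient
   inequalities with opposite signs and cancels. Four errors [k] remain, as [b - c] counts twice. *)
have lin (a b c d D0 D D' k : R) : a - b - D0 <= k -> b - c <= k ->
  - k <= b - d -> c + (D - D') <= a -> c + D' <= d -> D - D0 <= 4 * k by lra.
have -> : e * s = 4 * (e / 4 * s) by field.
move=> h2 h3; exact: lin h1 n1 n2 h3 h2.
Qed.

End Convex.

End ScalarC1.

(** * Smooth bumps *)

(* Junk value: bump 0 x y = 1, as division by 0 gives 0. *)
Definition bump {R : realType} {X : normedModType R} (r : R) (x y : X) : R :=
  Num.max 0 (1 - `|y - x| ^+ 2 / r ^+ 2) ^+ 2.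

Section Bump.
Context {R : realType} {X : normedModType R}.
Implicit Types (r : R) (x y : X).

Lemma bumpxx r x : bump r x x = 1.
Proof. by rewrite /bump subrr normr0 expr0n mul0r subr0 max_r// expr1n. Qed.

Lemma bump01 r x y : 0 <= bump r x y <= 1.
Proof.
rewrite /bump exprn_ge0 ?le_max ?lexx//= exprn_ile1 ?le_max ?lexx//.
by rewrite ge_max ler01 gerBl divr_ge0 ?sqr_ge0.
Qed.

Lemma bump_out r x y : 0 < r -> r <= `|y - x| -> bump r x y = 0.
Proof.
move=> r0 ryx; rewrite /bump max_l ?expr0n// subr_le0 ler_pdivlMr ?exprn_gt0//.
by rewrite mul1r lerXn2r// nnegrE// ltW.
Qed.

(** After scaling by [r], the profile is the square of the positive part of [1 - s ^+ 2]. On [0, 1]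
    this factor stays in [0, 1] and has slope at most 2, so squaring gives the constant 4. *)
Lemma bump_lip r x y y' : 0 < r ->
  `|bump r x y - bump r x y'| <= 4 / r * `|y - y'|.
Proof.
move=> r0; have yy' : `| `|y - x| - `|y' - x| | <= `|y - y'|.
  by rewrite (le_trans (ler_dist_dist _ _))// opprB addrA subrK.
rewrite mulrAC ler_pdivlMr//.
have : `| `|y - x| / r - `|y' - x| / r | * r <= `|y - y'|.
  by rewrite -{3}(gtr0_norm r0) -normrM mulrBl !divfK ?gt_eqF.
rewrite /bump -!expr_div_n.
have : 0 <= `|y - x| / r by rewrite divr_ge0// ltW.
have : 0 <= `|y' - x| / r by rewrite divr_ge0// ltW.
move: (`|y' - x| / r) (`|y - x| / r) => s' s s'0 s0 ss'.
rewrite (le_trans _ (ler_wpM2l _ ss'))// mulrA ler_pM2r//.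
suff H (a b : R) : 0 <= a -> a <= b -> `|Num.max 0 (1 - a ^+ 2) ^+ 2 -
    Num.max 0 (1 - b ^+ 2) ^+ 2| <= 4 * `|a - b|.
  have [ss|/ltW ss] := leP s s'; first exact: H.
  by rewrite distrC (distrC s); exact: H.
move=> a0 ab; rewrite (distrC a) (ger0_norm (_ : 0 <= b - a)) ?subr_ge0//.
have [b1|b1] := leP b 1.
  have B0 : 0 <= 1 - b ^+ 2 by nra.
  have BA : 1 - b ^+ 2 <= 1 - a ^+ 2 by nra.
  have A1 : 1 - a ^+ 2 <= 1 by nra.
  have AB : (1 - a ^+ 2) - (1 - b ^+ 2) <= 2 * (b - a) by nra.
  rewrite !max_r//; last exact: le_trans BA.
  move: (1 - a ^+ 2) (1 - b ^+ 2) B0 BA A1 AB => A B B0 BA A1 AB.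
  by rewrite ger0_norm; nra.
rewrite (@max_l _ _ _ (1 - b ^+ 2)); last nra.
have [a1|a1] := leP a 1.
  have A0 : 0 <= 1 - a ^+ 2 by nra.
  have A1 : 1 - a ^+ 2 <= 1 by nra.
  have A2 : 1 - a ^+ 2 <= 2 * (1 - a) by nra.
  rewrite max_r// expr0n subr0 ger0_norm ?exprn_ge0//.
  move: (1 - a ^+ 2) A0 A1 A2 => A A0 A1 A2; nra.
rewrite max_l; last nra.
rewrite subrr normr0; lra.
Qed.

Lemma bump_cont (r : X -> R) y x : {for x, continuous r} -> r x != 0 ->
  {for x, continuous (fun u => bump (r u) u y)}.
Proof.
move=> rc r0.
have sqc (h : X -> R) : {for x, continuous h} ->
    {for x, continuous (fun u => h u ^+ 2)}.
  by move=> hc; apply: cvgM.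
apply: (sqc _); apply: continuous_max0.
apply: cvgB; first exact: cvg_cst.
apply: cvgM.
  apply: (sqc _); apply: cvg_norm.
  by apply: cvgB; [exact: cvg_cst|exact: cvg_id].
by apply: cvgV; [rewrite expf_neq0|exact: (sqc _)].
Qed.

Hypothesis normX : differentiable_norm X.

Lemma differentiable_sqdist x y : differentiable (fun y => `|y - x| ^+ 2) y.
Proof.
have [->|yx] := eqVneq y x; last first.
  have dB : differentiable (fun y => y - x) y.
    by apply: differentiableB.
  have dn : differentiable (fun u : X => `|u| : R) (y - x).
    by apply: normX; rewrite subr_eq0.
  have dN := differentiable_comp dB dn.
  have dsq (t : R) : differentiable (fun t : R => t ^+ 2) t.
    exact/derivable1_diffP/exprn_derivable.
  exact: differentiable_comp dN (dsq _).
(* At the centre the norm need not be differentiable, but its square is, with derivative 0. *)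
apply: (@diffI _ _ _ _ (fun=> 0) x _ _ _).1.
- by move=> a u v; rewrite scaler0 addr0.
- exact: cst_continuous.
- move=> e e0; apply/nbhs_normP; exists e => // u.
  rewrite /ball_ /= sub0r normrN => ue.
  rewrite addrK subrr normr0 expr0n !subr0 ger0_norm ?exprn_ge0// expr2.
  by rewrite ler_wpM2r// ltW.
Qed.

Lemma C1_sqdist x : C1 (fun y => `|y - x| ^+ 2).
Proof.
apply: convex_C1; last exact: differentiable_sqdist.
move=> u v t /andP[t0 t1].
have : `|u + t *: (v - u) - x| <= (1 - t) * `|u - x| + t * `|v - x|.
  have -> : u + t *: (v - u) - x = (1 - t) *: (u - x) + t *: (v - x).
    have -> : v - u = (v - x) - (u - x) by rewrite opprB addrA subrK.
    by rewrite scalerBl scale1r scalerBr addrAC addrA addrAC.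
  by rewrite (le_trans (ler_normD _ _))// !normrZ !ger0_norm// subr_ge0.
have := normr_ge0 (u + t *: (v - u) - x).
move: `|_ + _ - x| `|u - x| `|v - x| => c a b c0 cab.
have : c ^+ 2 <= ((1 - t) * a + t * b) ^+ 2 by rewrite lerXn2r// nnegrE; lra.
(* This is the convexity gap of the square, [(1 - t) * a ^+ 2 + t * b ^+ 2] minus the square of
   [(1 - t) * a + t * b]. *)
have : 0 <= (1 - t) * t * (a - b) ^+ 2.
  by rewrite mulr_ge0 ?sqr_ge0// mulr_ge0// subr_ge0.
nra.
Qed.

(** Squaring removes the kink of the positive part: the derivative is [2 * Num.max 0 a], with a
    quadratic remainder. *)
Let W (a b : R) : `|Num.max 0 (a + b) ^+ 2 - Num.max 0 a ^+ 2
  - 2 * Num.max 0 a * b| <= b ^+ 2.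
Proof.
have [a0|/ltW a0] := leP 0 a; have [ab|/ltW ab] := leP 0 (a + b);
  rewrite ?(max_r a0) ?(max_l a0) ?(max_r ab) ?(max_l ab) ler_norml; nra.
Qed.

Lemma C1_bump r x : C1 (bump r x).
Proof.
pose P t : R := Num.max 0 (1 - t / r ^+ 2) ^+ 2.
pose p t : R := - 2 * Num.max 0 (1 - t / r ^+ 2) / r ^+ 2.
have p_cont : continuous p.
  move=> t; apply: cvgM; last exact: cvg_cst.
  apply: cvgM; first exact: cvg_cst.
  apply: (@continuous_max0 R R (fun u => 1 - u / r ^+ 2)).
  apply: cvgB; first exact: cvg_cst.
  by apply: cvgM; [exact: cvg_id|exact: cvg_cst].
apply: (@C1_comp _ _ P p _ _ p_cont (C1_sqdist x)) => t.
apply: diffI.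
- by move=> a u v; rewrite /GRing.scale/=; ring.
- by move=> s; apply: cvgM; [exact: cvg_cst|exact: cvg_id].
move=> e e0; pose q := r ^- 2.
have q1 : 0 < 1 + q ^+ 2 by rewrite ltr_pwDl// sqr_ge0.
apply/nbhs_normP; exists (e / (1 + q ^+ 2)) => /= [|s].
  by rewrite divr_gt0.
rewrite /ball_ /= sub0r normrN ltr_pdivlMr// => se.
have := W (1 - t * q) (- (s * q)).
have -> : 1 - t * q + - (s * q) = 1 - (s + t) * q by ring.
rewrite /P /p -/q => w; apply: le_trans (_ : (- (s * q)) ^+ 2 <= _).
  apply: le_trans w; rewrite le_eqVlt; apply/orP; left; apply/eqP.
  by congr (`|_|); ring.
have -> : (- (s * q)) ^+ 2 = `|s| * q ^+ 2 * `|s|.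
  by rewrite sqrrN exprMn -(real_normK (num_real s)); ring.
rewrite ler_wpM2r//; have := normr_ge0 s; lra.
Qed.

End Bump.

(** * Stable limits are diagonals of smooth functions *)

Section SeparatelySmooth.
Context {R : realType} {X Z : normedModType R}.
Hypothesis normX : differentiable_norm X.
Variables (g : X -> Z) (g_ : nat -> X -> Z) (N : X -> nat).
Hypotheses (g_cont : forall n, continuous (g_ n))
  (g_stable : forall x n, (N x < n)%N -> g_ n x = g x).

Let d k x := g_ k.+1 x - g_ k x.

Let zeros k := [set x | d k x = 0].

(* The radius is positive off zeros k, and it is so small that y in zeros k
   annihilates term k x y for every x. *)
Let term k x y := bump (capped_dist (zeros k) x) x y *: d k x.

Definition smooth_diagonal (p : X * X) : Z :=
  g_ 0%N p.1 + \sum_(k < (N p.1).+1) term k p.1 p.2.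

Let d_cont k : continuous (d k).
Proof. by move=> x; apply: cvgB; exact: g_cont. Qed.

Let zeros_closed k : closed (zeros k).
Proof.
apply: (@preimage_closed _ _ (d k) [set 0]); first by move=> x _; exact: d_cont.
exact/accessible_closed_set1/hausdorff_accessible/norm_hausdorff.
Qed.

Let radius_gt0 k x : d k x != 0 -> 0 < capped_dist (zeros k) x.
Proof. by move=> /eqP dx; exact: capped_dist_gt0. Qed.

Let d_eq0 k x : (N x < k)%N -> d k x = 0.
Proof. by move=> Nk; rewrite /d !g_stable ?subrr// ltnS ltnW. Qed.

Let term_eq0l k x y : (N x < k)%N -> term k x y = 0.
Proof. by move=> /d_eq0 dx; rewrite /term dx scaler0. Qed.

Let term_eq0r k x y : (N y < k)%N -> term k x y = 0.
Proof.
move=> /d_eq0 dy; have [dx|dx] := eqVneq (d k x) 0.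
  by rewrite /term dx scaler0.
rewrite /term bump_out ?scale0r//; first exact: radius_gt0.
by rewrite distrC; exact: capped_dist_le.
Qed.

Let sum_term x y m n : (forall k, (m < k)%N -> term k x y = 0) -> (m <= n)%N ->
  \sum_(k < n.+1) term k x y = \sum_(k < m.+1) term k x y.
Proof.
move=> t0; elim: n => [|n IH]; first by rewrite leqn0 => /eqP <-.
rewrite leq_eqVlt => /predU1P[<-//|mn].
by rewrite big_ord_recr/= IH// t0 ?addr0.
Qed.

(** Terms beyond [N x] and terms beyond [N y] all vanish, so the cut may depend on [y] instead. For
    fixed [y] the range of summation then no longer moves with [x]. *)
Lemma smooth_diagonalE x y :
  smooth_diagonal (x, y) = g_ 0%N x + \sum_(k < (N y).+1) term k x y.
Proof.
rewrite /smooth_diagonal/=; congr (_ + _).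
rewrite -(@sum_term x y (N x) (maxn (N x) (N y))) ?leq_maxl//; last first.
  by move=> k; exact: term_eq0l.
by rewrite (@sum_term x y (N y)) ?leq_maxr// => k; exact: term_eq0r.
Qed.

Lemma smooth_diagonal_diag x : smooth_diagonal (x, x) = g x.
Proof.
(* The sum telescopes up to [g_ (N x).+1 x], the first index at which [g_stable] applies. *)
rewrite /smooth_diagonal/= (eq_bigr (fun k : 'I_(N x).+1 => d k x)) => [|k _].
  rewrite -(big_mkord xpredT (fun k => d k x)) /d telescope_sumr//.
  by rewrite addrC subrK g_stable.
by rewrite /term bumpxx scale1r.
Qed.

Lemma smooth_diagonal_cont y : continuous (fun x => smooth_diagonal (x, y)).
Proof.
under eq_fun do rewrite smooth_diagonalE.
move=> x; apply: cvgD; first exact: g_cont.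
apply: cvg_big => [|k _]; first exact: add_continuous.
have [dx|dx] := eqVneq (d k x) 0; last first.
  apply: cvgZ; last exact: d_cont.
  apply: bump_cont; first exact: capped_dist_cont.
  by rewrite gt_eqF// radius_gt0.
apply/cvgrPdist_le => e e0; have /cvgrPdist_le/(_ _ e0) := @d_cont k x.
apply: filterS => u; rewrite /term dx scaler0 !sub0r !normrN normrZ.
apply: le_trans; have /andP[b0 b1] := bump01 (capped_dist (zeros k) u) u y.
by rewrite ger0_norm// ler_piMl.
Qed.

Lemma smooth_diagonal_C1 x : C1 (fun y => smooth_diagonal (x, y)).
Proof.
have term_C1 k : C1 (term k x) by exact/C1Zl/C1_bump.
exact: C1D (C1_cst (g_ 0%N x)) (C1_sum (N x).+1 term_C1).
Qed.

Lemma smooth_diagonal_lip x : lipschitz (fun y => smooth_diagonal (x, y)).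
Proof.
have lip_term k : exists M, forall y y',
    `|term k x y - term k x y'| <= M * `|y - y'|.
  have [dx|dx] := eqVneq (d k x) 0.
    by exists 0 => y y'; rewrite /term dx !scaler0 subrr normr0 mul0r.
  exists (4 / capped_dist (zeros k) x * `|d k x|) => y y'.
  rewrite -scalerBl normrZ mulrAC ler_wpM2r//.
  exact/bump_lip/radius_gt0.
pose M k := projT1 (boolp.cid (lip_term k)).
have MP k y y' : `|term k x y - term k x y'| <= M k * `|y - y'|.
  exact: projT2 (boolp.cid (lip_term k)) y y'.
have proper : ProperFilter (globally ([set: X] `*` [set: X])).
  exact: (globally_properfilter (a := (0, 0))).
apply: (@klipschitzW _ _ _ (\sum_(k < (N x).+1) M k)) => -[y y'] _ /=.
rewrite /smooth_diagonal/= opprD addrACA subrr add0r -sumrB.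
by rewrite (le_trans (ler_norm_sum _ _ _))// mulr_suml ler_sum.
Qed.

End SeparatelySmooth.

Theorem theorem6p2 (R : realType) (X Z : normedModType R)
    (normX : differentiable_norm X) (g : X -> Z) :
  [<-> stable_Baire1 g;
       exists f : X * X -> Z,
         [/\ forall x, f (x, x) = g x,
             forall y, continuous (fun x => f (x, y)),
             forall x, lipschitz (fun y => f (x, y)) &
             forall x, continuously_differentiable (fun y => f (x, y))];
       exists f : X * X -> Z,
         [/\ forall x, f (x, x) = g x,
             forall y, continuous (fun x => f (x, y)) &
             forall x, lipschitz_at (fun y => f (x, y)) x]].
Proof.
tfae.
- move=> [g_ [g_cont /choice[N g_stable]]].
  exists (smooth_diagonal g_ N); split.
  + exact: smooth_diagonal_diag.
  + exact: smooth_diagonal_cont g_stable.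
  + exact: smooth_diagonal_lip.
  + by move=> x; apply/C1_continuously_differentiable/smooth_diagonal_C1.
- move=> [f [fg f_cont f_lip _]]; exists f; split=> // x.
  (* [lipschitz] gives the bound for the constants strictly above some [M], hence [M + 1]. *)
  have [M [_ MP]] := f_lip x; have M1 : M < M + 1 by rewrite ltrDl.
  exists (M + 1) => _ [y /= yx <-].
  rewrite ler_pdivrMr; last by rewrite normr_gt0 subr_eq0 eq_sym.
  exact: (MP _ M1 (x, y)).
- move=> [f [fg f_cont f_lip]].
  have -> : g = fun x => f (x, x) by apply/funext => x; rewrite fg.
  exact: stable_Baire1_diagonal.
Qed.
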